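(* Let $r,s$ be integers with $s\geq r$, and let $a_1,\dots,a_r,b_1,\dots,b_s,a,c,d,x,t$ be complex numbers such that $x$ and $b_i$ ($1\le i\le s$) are not of the form $q^{-n}$ and $d\neq aq^n$ for positive integers $n$, and $|xd|<1$. Then \[ \frac{1}{1-xd}\,{}_{r+1}\widetilde{\phi}_{s+1}\left[\begin{matrix}a_{1},\dots,a_{r},cq/x\\ b_{1},\dots,b_s,xdq\end{matrix} ; q, xt\right] =\sum_{n=0}^{\infty}(1-acq^{2n+2})\,(xd)^{n}\frac{(aq/d,cq/x;q)_{n} }{(cdq,axq;q)_{n+1}}\; {}_{r+3}\phi _{s+2}\left[\begin{matrix}cdq,q^{-n},acq^{n+2},a_{1},\dots,a_{r}\\ cdq^{n+2},q^{-n}d/a,b_{1},\dots,b_{s}\end{matrix}; q, \frac{t}{a}\right]. \]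
   Context: Fix $q\in\mathbb{C}$ with $|q|<1$. For $a\in\mathbb{C}$ and integer $n\ge 0$: $(a;q)_\infty=\prod_{k\ge0}(1-aq^k)$, $(a;q)_n=(a;q)_\infty/(aq^n;q)_\infty$, and $(a_1,\dots,a_m;q)_n=(a_1;q)_n\cdots(a_m;q)_n$. Write $\tau(n)=(-1)^nq^{\binom n2}$. Basic hypergeometric series: ${}_{r}\phi _{s}\left[\begin{matrix}a_{1},\dots ,a_{r}\\ b_{1},\dots ,b_{s}\end{matrix}; q, z\right]=\sum_{n\ge0}\frac{(a_1,\dots,a_r;q)_n}{(b_1,\dots,b_s;q)_n}\tau(n)^{1+s-r}\frac{z^n}{(q;q)_n}$ and ${}_{r}\widetilde{\phi} _{s}\left[\begin{matrix}a_{1},\dots ,a_{r}\\ b_{1},\dots ,b_{s}\end{matrix}; q, z\right]=\sum_{n\ge0}\frac{(a_1,\dots,a_r;q)_n}{(b_1,\dots,b_s;q)_n}\tau(n)^{s-r}z^n$.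
   Formalization: As stated the formula can be undefined (e.g. for r = s and |xt| ≥ 1 the left series generally diverges); it is read with q, a, d, x nonzero, cd and ax not of the form q^{-n} (n ≥ 1), b_i ≠ 1 as well, and, when r = s, the left-hand series assumed convergent. *)

(* Defs.v *)
From Stdlib Require Import Reals ZArith List Lia.
From Coquelicot Require Import Coquelicot.
Import ListNotations.

Open Scope C_scope.

(** [(a;q)_n] as the finite product [(1 - a) (1 - a q) ... (1 - a q^(n-1))].
    The quotient [(a;q)_oo / (a q^n;q)_oo] agrees with it whenever its
    denominator is nonzero ([qpoch_quotient] below), but reads 0/0 at
    [a = q^(-m)], [m >= n], where [(q^(-m);q)_n] is still needed. *)
Fixpoint qpoch (a q : C) (n : nat) : C :=
  match n with
  | O => 1
  | S m => qpoch a q m * (1 - a * q ^ m)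
  end.

Definition is_qpoch_inf (a q P : C) : Prop :=
  filterlim (fun n => qpoch a q n) eventually (locally P).

Definition qpochs (l : list C) (q : C) (n : nat) : C :=
  fold_right (fun a p => qpoch a q n * p) 1 l.

Definition Cpowz (z : C) (k : Z) : C :=
  match k with
  | Z0 => 1
  | Zpos p => z ^ Pos.to_nat p
  | Zneg p => / z ^ Pos.to_nat p
  end.

Definition tau (q : C) (n : nat) : C :=
  (- (1)) ^ n * q ^ (n * (n - 1) / 2).

(** The sum of a convergent complex series; unspecified otherwise. *)
Definition CSeries (u : nat -> C) : C :=
  iota (T := C_CompleteNormedModule) (fun l => is_series u l).

Definition phi_term (al bl : list C) (q z : C) (n : nat) : C :=
  qpochs al q n / qpochs bl q n
  * Cpowz (tau q n) (1 + Z.of_nat (length bl) - Z.of_nat (length al))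
  * (z ^ n / qpoch q q n).

Definition phi (al bl : list C) (q z : C) : C := CSeries (phi_term al bl q z).

Definition tphi_term (al bl : list C) (q z : C) (n : nat) : C :=
  qpochs al q n / qpochs bl q n
  * Cpowz (tau q n) (Z.of_nat (length bl) - Z.of_nat (length al))
  * z ^ n.

Definition tphi (al bl : list C) (q z : C) : C := CSeries (tphi_term al bl q z).

Lemma CSeries_correct (u : nat -> C) (l : C) : is_series u l -> CSeries u = l.
Proof.
intros H; unfold CSeries, is_series.
exact (iota_filterlim_locally (V := C_CompleteNormedModule)
         (F := eventually) (sum_n u) l H).
Qed.

Lemma qpoch_add (a q : C) (n m : nat) :
  qpoch a q (n + m) = qpoch a q n * qpoch (a * q ^ n) q m.
Proof.
induction m as [|m IH].
- rewrite Nat.add_0_r; simpl; ring.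
- rewrite Nat.add_succ_r; simpl; rewrite IH, Cpow_add_r; ring.
Qed.

Lemma qpoch_quotient (a q P Q : C) (n : nat) :
  is_qpoch_inf a q Q -> is_qpoch_inf (a * q ^ n) q P -> P <> 0 ->
  qpoch a q n = Q / P.
Proof.
intros HQ HP nzP.
assert (E : Q = qpoch a q n * P).
{ apply (filterlim_locally_unique (K := C_AbsRing) (V := C_NormedModule)
           (F := eventually) (fun m => qpoch a q (m + n))).
  - apply filterlim_comp with (2 := HQ).
    intros A [N HN]; exists N; intros m Hm; apply HN; lia.
  - apply filterlim_ext with
      (fun m => scal (qpoch a q n : C_AbsRing)
                     (qpoch (a * q ^ n) q m : C_NormedModule)).
    + intros m; rewrite Nat.add_comm; symmetry; apply qpoch_add.
    + apply filterlim_comp with (1 := HP).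
      apply (filterlim_scal_r (K := C_AbsRing) (V := C_NormedModule)). }
rewrite E; field; exact nzP.
Qed.

(* Main.v *)
(** For [n >= k] the coefficient of
    [(a_1..a_r)_k / (b_1..b_s)_k tau(k)^(s-r) t^k] in the [n]-th summand on the
    right is [x^k (cq/x)_k] times the term of index [m = n - k] of a
    nonterminating very-well-poised [6phi5] series with base [acq^(2k+2)],
    parameters [aq/d, cq^(k+1)/x, q^(k+1)] and argument [xd].  Its sum is
    [1 / (xd)_(k+1)]: for [k = 0] the series telescopes, and a WZ-type
    certificate carries the sum from [k] to [k+1].  Summing over [k] yields the
    left-hand side.  The interchange of summations is legitimate since the
    [6phi5] terms are [O(|xd|^m)] uniformly in [k] while the left-hand series
    converges absolutely. *)
Require Import Defs.
From Stdlib Require Import Reals ZArith List.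
From Stdlib Require Import Lra Lia Classical.
From Coquelicot Require Import Coquelicot.
Import ListNotations.
Open Scope C_scope.

(** * Bounds for q-shifted factorials, uniform in their length *)

Lemma qpoch_S_l (a q : C) (n : nat) :
  qpoch a q (S n) = (1 - a) * qpoch (a * q) q n.
Proof.
change (S n) with (1 + n)%nat; rewrite qpoch_add; simpl.
rewrite !Cmult_1_r; ring.
Qed.

Lemma Cmod_1_sub_le (a : C) : (Cmod (1 - a) <= 1 + Cmod a)%R.
Proof.
unfold Cminus; eapply Rle_trans; [apply Cmod_triangle|].
rewrite Cmod_1, Cmod_opp; lra.
Qed.

Lemma Cmod_1_sub_ge (a : C) : (1 - Cmod a <= Cmod (1 - a))%R.
Proof.
generalize (Cmod_triangle (1 - a) a).
replace (1 - a + a) with (1 : C) by ring; rewrite Cmod_1; lra.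
Qed.

Lemma exp_le_mono (x y : R) : (x <= y)%R -> (exp x <= exp y)%R.
Proof.
intros [H| ->]; [left; apply exp_increasing, H|apply Rle_refl].
Qed.

(** Each factor satisfies [|1 - u| <= exp |u|], and the moduli [|a q^k|] sum to at most
    [|a| / (1 - |q|)]. *)
Lemma Cmod_qpoch_le (q : C) (n : nat) (a : C) :
  (Cmod q < 1)%R -> (Cmod (qpoch a q n) <= exp (Cmod a / (1 - Cmod q)))%R.
Proof.
intros Hq; revert a; induction n as [|n IH]; intros a.
- simpl; rewrite Cmod_1; apply Rle_trans with (exp 0); [rewrite exp_0; lra|].
  apply exp_le_mono.
  apply Rmult_le_pos; [apply Cmod_ge_0|left; apply Rinv_0_lt_compat; lra].
- rewrite qpoch_S_l, Cmod_mult.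
  replace (Cmod a / (1 - Cmod q))%R
    with (Cmod a + Cmod (a * q) / (1 - Cmod q))%R
    by (rewrite Cmod_mult; field; lra).
  rewrite exp_plus; apply Rmult_le_compat; auto using Cmod_ge_0.
  eapply Rle_trans; [apply Cmod_1_sub_le|apply exp_ineq1_le].
Qed.

Lemma Cmod_qpoch_bound (q : C) (R : R) :
  (Cmod q < 1)%R ->
  exists B, (0 < B)%R /\
    forall a n, (Cmod a <= R)%R -> (Cmod (qpoch a q n) <= B)%R.
Proof.
intros Hq; exists (exp (R / (1 - Cmod q))); split; [apply exp_pos|].
intros a n Ha; eapply Rle_trans; [apply Cmod_qpoch_le, Hq|].
apply exp_le_mono, Rmult_le_compat_r; [left; apply Rinv_0_lt_compat; lra|exact Ha].
Qed.

(** Weierstrass's inequality: a product of factors [1 - u_k] with small [u_k >= 0] is at least [1]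
    minus the sum of the [u_k]. With [y = |a| / (1 - |q|)] the inductive step is
    [(1 - y (1 - |q|)) (1 - y |q|) >= 1 - y]. *)
Lemma Cmod_qpoch_ge (q : C) (n : nat) (a : C) :
  (Cmod q < 1)%R -> (Cmod a / (1 - Cmod q) <= 1)%R ->
  (1 - Cmod a / (1 - Cmod q) <= Cmod (qpoch a q n))%R.
Proof.
intros Hq; revert a; induction n as [|n IH]; intros a Ha.
- simpl; rewrite Cmod_1.
  assert (0 <= Cmod a / (1 - Cmod q))%R; [|lra].
  apply Rmult_le_pos; [apply Cmod_ge_0|left; apply Rinv_0_lt_compat; lra].
- set (y := (Cmod a / (1 - Cmod q))%R) in *.
  assert (Hy : (0 <= y)%R).
  { apply Rmult_le_pos; [apply Cmod_ge_0|left; apply Rinv_0_lt_compat; lra]. }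
  assert (Ea : Cmod a = (y * (1 - Cmod q))%R) by (unfold y; field; lra).
  assert (Eq : (Cmod (a * q) / (1 - Cmod q))%R = (y * Cmod q)%R).
  { rewrite Cmod_mult; unfold y; field; lra. }
  specialize (IH (a * q)); rewrite Eq in IH.
  generalize (Cmod_ge_0 q) (Cmod_1_sub_ge a); intros Hq0 H1.
  rewrite Ea in H1.
  rewrite qpoch_S_l, Cmod_mult.
  apply Rle_trans with ((1 - y * (1 - Cmod q)) * (1 - y * Cmod q))%R.
  + assert (0 <= y * (1 - Cmod q))%R by (apply Rmult_le_pos; lra).
    assert (0 <= y * Cmod q)%R by (apply Rmult_le_pos; lra).
    nra.
  + apply Rmult_le_compat; try nra; apply IH; nra.
Qed.

Lemma Cpow_lt_eventually (q : C) (K eps : R) :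
  (Cmod q < 1)%R -> (0 < eps)%R -> exists N, (K * Cmod q ^ N < eps)%R.
Proof.
intros Hq He.
assert (H : is_lim_seq (fun n => K * Cmod q ^ n)%R 0).
{ replace (Finite 0) with (Rbar_mult K 0) by (simpl; f_equal; ring).
  apply is_lim_seq_scal_l, is_lim_seq_geom.
  rewrite Rabs_pos_eq; [exact Hq|apply Cmod_ge_0]. }
apply is_lim_seq_spec in H; destruct (H (mkposreal eps He)) as [N HN].
exists N; specialize (HN N (le_n N)); simpl in HN.
rewrite Rminus_0_r in HN; eapply Rle_lt_trans; [apply Rle_abs|exact HN].
Qed.

(** After [N] factors are peeled off, the base [a q^N] is so small that the preceding bound gives at
    least [1/2]; the peeled factors are finitely many and nonzero. *)
Lemma Cmod_qpoch_lower (q a : C) :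
  (Cmod q < 1)%R -> (forall n, a * q ^ n <> 1) ->
  exists e, (0 < e)%R /\ forall n, (e <= Cmod (qpoch a q n))%R.
Proof.
intros Hq.
destruct (Cpow_lt_eventually q (Cmod a / (1 - Cmod q)) (1 / 2) Hq) as [N HN];
  [lra|].
revert a HN; induction N as [|N IH]; intros a HN Ha.
- exists (1 / 2)%R; split; [lra|]; intros n.
  simpl in HN; rewrite Rmult_1_r in HN.
  generalize (Cmod_qpoch_ge q n a Hq); lra.
- destruct (IH (a * q)) as (e & He & H).
  + rewrite Cmod_mult; simpl in HN.
    replace (Cmod a * Cmod q / (1 - Cmod q) * Cmod q ^ N)%R
      with (Cmod a / (1 - Cmod q) * (Cmod q * Cmod q ^ N))%R
      by (field; lra).
    exact HN.
  + intros n; rewrite <- Cmult_assoc; exact (Ha (S n)).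
  + assert (H1 : (0 < Cmod (1 - a))%R).
    { apply Cmod_gt_0; intros E; apply (Ha O); simpl.
      replace (a * 1) with (1 - (1 - a)) by ring; rewrite E; ring. }
    (* The minimum with [1] covers the empty product, from which no factor can be peeled. *)
    exists (Rmin 1 (Cmod (1 - a) * e)); split.
    * apply Rmin_pos; [lra|]; apply Rmult_lt_0_compat; assumption.
    * intros [|n].
      -- simpl; rewrite Cmod_1; apply Rmin_l.
      -- eapply Rle_trans; [apply Rmin_r|].
         rewrite qpoch_S_l, Cmod_mult.
         apply Rmult_le_compat_l; [lra|apply H].
Qed.

Lemma qpoch_S_r (a q : C) (n : nat) :
  qpoch a q (S n) = qpoch a q n * (1 - a * q ^ n).
Proof. reflexivity. Qed.

Lemma one_sub_neq_0 (z : C) : z <> 1 -> 1 - z <> 0.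
Proof.
intros H E; apply H; replace z with (1 - (1 - z)) by ring; rewrite E; ring.
Qed.

Lemma qpoch_neq_0_lt (q a : C) (n : nat) :
  (forall j, (j < n)%nat -> a * q ^ j <> 1) -> qpoch a q n <> 0.
Proof.
induction n as [|n IH]; intros Ha; [exact C1_nz|]; rewrite qpoch_S_r.
apply Cmult_neq_0; [apply IH; intros; apply Ha; lia|].
apply one_sub_neq_0, Ha; lia.
Qed.

Lemma qpoch_neq_0 (q a : C) (n : nat) :
  (forall j, a * q ^ j <> 1) -> qpoch a q n <> 0.
Proof. intros Ha; apply qpoch_neq_0_lt; auto. Qed.

Lemma qpoch_eq_0 (q a : C) (j n : nat) :
  a * q ^ j = 1 -> (j < n)%nat -> qpoch a q n = 0.
Proof.
intros E; induction n as [|n IH]; intros Hn; [lia|]; simpl.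
destruct (Nat.eq_dec j n) as [->|Hj]; [rewrite E; ring|].
rewrite IH by lia; ring.
Qed.

(** * Complex series and summation along antidiagonals *)

(** Turns complex convergence into a real limit, so that squeeze arguments apply. *)
Lemma is_series_Cmod (u : nat -> C) (l : C) :
  is_series u l <-> is_lim_seq (fun n => Cmod (sum_n u n - l)) 0.
Proof.
assert (E : forall n, Rabs (Cmod (sum_n u n - l) - 0) = Cmod (sum_n u n - l)).
{ intros n; rewrite Rminus_0_r; apply Rabs_pos_eq, Cmod_ge_0. }
assert (B := filterlim_locally_ball_norm (K := C_AbsRing)
  (U := C_NormedModule) (F := eventually) (sum_n u) l).
split.
- intros H; apply is_lim_seq_spec; intros eps.
  destruct (proj1 B H eps) as [N HN].
  exists N; intros n Hn; rewrite E; exact (HN n Hn).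
- intros H; apply is_lim_seq_spec in H; apply (proj2 B); intros eps.
  destruct (H eps) as [N HN]; exists N; intros n Hn.
  generalize (HN n Hn); rewrite E; exact (fun h => h).
Qed.

Lemma sum_n_CS (u : nat -> C) (n : nat) : sum_n u (S n) = sum_n u n + u (S n).
Proof. exact (sum_Sn u n). Qed.

Lemma sum_n_C0 (u : nat -> C) : sum_n u 0 = u O.
Proof. exact (sum_O u). Qed.

Lemma is_series_Cscal (z : C) (u : nat -> C) (l : C) :
  is_series u l -> is_series (fun n => z * u n) (z * l).
Proof. exact (is_series_scal (K := C_AbsRing) (V := C_NormedModule) z u l). Qed.

Lemma is_series_finite (u : nat -> C) (n : nat) :
  (forall k, (n < k)%nat -> u k = 0) -> is_series u (sum_n u n).
Proof.
intros Hu; apply is_series_Cmod.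
apply (is_lim_seq_ext_loc (fun _ => 0%R)); [|apply is_lim_seq_const].
exists n; intros m Hm; replace (sum_n u m) with (sum_n u n).
- unfold Cminus; rewrite Cplus_opp_r, Cmod_0; reflexivity.
- induction Hm as [|m Hm IH]; [reflexivity|].
  rewrite sum_n_CS, Hu, Cplus_0_r by lia; exact IH.
Qed.

Lemma Cmod_is_series_le (u : nat -> C) (l : C) (B : R) :
  is_series u l -> (forall n, Cmod (sum_n u n) <= B)%R -> (Cmod l <= B)%R.
Proof.
intros H HB; apply is_series_Cmod in H.
apply (is_lim_seq_le (fun _ => Cmod l)
  (fun n => B + Cmod (sum_n u n - l))%R (Cmod l) B).
- intros n; eapply Rle_trans; [|apply Rplus_le_compat_r, (HB n)].
  replace l with (sum_n u n + - (sum_n u n - l)) at 1 by ring.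
  eapply Rle_trans; [apply Cmod_triangle|]; rewrite Cmod_opp; lra.
- apply is_lim_seq_const.
- replace (Finite B) with (Rbar_plus B 0) by (simpl; f_equal; ring).
  apply is_lim_seq_plus'; [apply is_lim_seq_const|exact H].
Qed.

Lemma Cmod_sum_n_le (u : nat -> C) (v : nat -> R) (n : nat) :
  (forall k, (k <= n)%nat -> Cmod (u k) <= v k)%R ->
  (Cmod (sum_n u n) <= sum_n v n)%R.
Proof.
induction n as [|n IH]; intros H.
- rewrite sum_n_C0, sum_O; apply H; lia.
- rewrite sum_n_CS, sum_Sn.
  eapply Rle_trans; [apply Cmod_triangle|].
  apply Rplus_le_compat; [apply IH; intros; apply H|apply H]; lia.
Qed.

Lemma is_series_geom_tail (u : nat -> C) (l : C) (W rho : R) (j : nat) :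
  (0 <= rho < 1)%R -> (0 <= W)%R ->
  (forall m, Cmod (u m) <= W * rho ^ m)%R -> is_series u l ->
  (Cmod (sum_n u j - l) <= W * rho ^ S j / (1 - rho))%R.
Proof.
intros Hr HW Hu Hl.
assert (T : is_series (fun k => u (S j + k)%nat) (l - sum_n u j)).
{ apply (is_series_incr_n (K := C_AbsRing) (V := C_NormedModule) u (S j));
    [lia|].
  change (is_series u (l - sum_n u j + sum_n u j)).
  replace (l - sum_n u j + sum_n u j) with l by ring; exact Hl. }
replace (sum_n u j - l) with (- (l - sum_n u j)) by ring.
rewrite Cmod_opp; apply (Cmod_is_series_le _ _ _ T); intros n.
eapply Rle_trans.
- apply (Cmod_sum_n_le _ (fun k => rho ^ k * (W * rho ^ S j))%R).
  intros k _; eapply Rle_trans; [apply Hu|].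
  rewrite pow_add; apply Req_le; ring.
- rewrite sum_n_Reals, <- scal_sum.
  apply Rmult_le_compat_l.
  + apply Rmult_le_pos; [exact HW|].
    apply (pow_le rho (S j)), Hr.
  + rewrite tech3 by lra.
    unfold Rdiv; rewrite <- (Rmult_1_l (/ (1 - rho))) at 2.
    apply Rmult_le_compat_r; [left; apply Rinv_0_lt_compat; lra|].
    generalize (pow_le rho (S n) (proj1 Hr)); simpl; lra.
Qed.

(** Passing from [N] to [S N] lengthens every row by its one entry on the new antidiagonal. *)
Lemma sum_n_triangle (H : nat -> nat -> C) (N : nat) :
  sum_n (fun n => sum_n (fun k => H k (n - k)%nat) n) N
  = sum_n (fun k => sum_n (H k) (N - k)) N.
Proof.
induction N as [|N IH].
- rewrite !sum_n_C0; reflexivity.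
- rewrite sum_n_CS, IH, !sum_n_CS, Nat.sub_diag, sum_n_C0, Cplus_assoc.
  f_equal; symmetry.
  rewrite (sum_n_ext_loc _
    (fun k => plus (sum_n (H k) (N - k)) (H k (S N - k)%nat))).
  + exact (sum_n_plus (fun k => sum_n (H k) (N - k))
             (fun k => H k (S N - k)%nat) N).
  + intros k Hk; replace (S N - k)%nat with (S (N - k)) by lia.
    apply sum_Sn.
Qed.

Lemma sum_n_Cminus (u v : nat -> C) (n : nat) :
  sum_n (fun k => u k - v k) n = sum_n u n - sum_n v n :> C.
Proof.
induction n as [|n IH]; [rewrite !sum_n_C0; reflexivity|].
rewrite !sum_n_CS, IH; ring.
Qed.

(** The triangle of size [N] differs from the sum of the first full rows only by row tails, the tail
    of row [k] being at most [w k * rho ^ (N - k)] times [rho / (1 - rho)]. These bounds add up to a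
    multiple of a Cauchy product term. *)
Lemma is_series_diagonal (H : nat -> nat -> C) (L : nat -> C) (l : C)
  (w : nat -> R) (rho : R) :
  (0 <= rho < 1)%R -> (forall k, 0 <= w k)%R -> ex_series w ->
  (forall k m, Cmod (H k m) <= w k * rho ^ m)%R ->
  (forall k, is_series (H k) (L k)) -> is_series L l ->
  is_series (fun n => sum_n (fun k => H k (n - k)%nat) n) l.
Proof.
intros Hr Hw Ew HH HL Hl; apply is_series_Cmod.
set (D := fun N => sum_n (fun k => H k (N - k)%nat) N).
(* This is the general term of the Cauchy product of [w] with the geometric series; both converge
   absolutely, so the product converges and its terms tend to 0. *)
assert (Hconv : is_lim_seq
  (fun N => sum_f_R0 (fun k => w k * rho ^ (N - k))%R N) 0).
{ apply ex_series_lim_0.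
  destruct Ew as [lw Ew].
  exists (lw * / (1 - rho))%R; apply (is_series_mult w (fun m => rho ^ m)%R).
  - exact Ew.
  - apply is_series_geom; rewrite Rabs_pos_eq; lra.
  - exists lw; apply (is_series_ext w); [|exact Ew].
    intros n; symmetry; apply Rabs_pos_eq, Hw.
  - exists (/ (1 - rho))%R; apply (is_series_ext (fun n => rho ^ n)%R).
    + intros n; symmetry; apply Rabs_pos_eq, pow_le, Hr.
    + apply is_series_geom; rewrite Rabs_pos_eq; lra. }
apply is_series_Cmod in Hl.
apply (is_lim_seq_le_le (fun _ => 0%R) _
  (fun N => rho / (1 - rho) * sum_f_R0 (fun k => w k * rho ^ (N - k)) N
            + Cmod (sum_n L N - l))%R).
- intros N; split; [apply Cmod_ge_0|].
  replace (sum_n D N - l) with ((sum_n D N - sum_n L N) + (sum_n L N - l))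
    by ring.
  eapply Rle_trans; [apply Cmod_triangle|]; apply Rplus_le_compat_r.
  assert (ED : sum_n D N - sum_n L N
               = sum_n (fun k => sum_n (H k) (N - k) - L k) N).
  { unfold D; rewrite sum_n_triangle; symmetry; apply sum_n_Cminus. }
  rewrite ED; eapply Rle_trans.
  + apply (Cmod_sum_n_le _
        (fun k => w k * rho ^ (N - k) * (rho / (1 - rho)))%R).
      intros k _.
      eapply Rle_trans; [exact (is_series_geom_tail _ _ _ _ (N - k) Hr (Hw k) (HH k) (HL k))|].
      apply Req_le; simpl; field; lra.
  + rewrite sum_n_Reals, <- scal_sum; apply Rle_refl.
- apply is_lim_seq_const.
- replace (Finite 0) with (Rbar_plus (Rbar_mult (rho / (1 - rho))%R 0) 0)
    by (simpl; f_equal; ring).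
  apply is_lim_seq_plus'; [|exact Hl].
  exact (is_lim_seq_scal_l _ (rho / (1 - rho))%R 0 Hconv).
Qed.

(** * The very-well-poised series and its certificate *)

(* The factor [(acq^(k+m+2))_k] stands for the usual quotient
   [(acq^(2k+2))_m / (acq^(k+2))_m], up to a factor independent of [m]; it
   needs no condition on [ac]. *)
Definition vwp_term (q a c d x : C) (k m : nat) : C :=
  (1 - a * c * q ^ (2 * (k + m) + 2)) * (x * d) ^ m
  * qpoch (a * q / d) q m * qpoch (c * q / x * q ^ k) q m
  * qpoch (q * q ^ k) q m * qpoch (a * c * q ^ (k + m + 2)) q k
  / (qpoch q q m * qpoch (c * d * q * q ^ k) q (k + m + 1)
     * qpoch (a * x * q) q (k + m + 1)).

(** Closed form of the sum of [vwp_term k j] over [j <= m] minus [1 - x d q^(k+1)] times the sum of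
    [vwp_term (S k) j] over [j < m], as the next two lemmas show under their hypotheses. *)
Definition vwp_cert (q a c d x : C) (k m : nat) : C :=
  (1 - c * d * q ^ (2 * k + 2)) * (x * d) ^ m
  * qpoch (a * q / d) q m * qpoch (c * q / x * q ^ S k) q m
  * qpoch (q * q ^ S k) q m * qpoch (a * c * q ^ (k + m + 2)) q (S k)
  / (qpoch q q m * qpoch (c * d * q * q ^ k) q (k + m + 2)
     * qpoch (a * x * q) q (k + m + 1)).

Lemma Cpow_q_neq_1 (q : C) (n : nat) : (Cmod q < 1)%R -> q * q ^ n <> 1.
Proof.
intros Hq E; assert (H : Cmod (q * q ^ n) = 1%R) by (rewrite E; apply Cmod_1).
rewrite Cmod_mult, Cmod_pow in H.
assert (Cmod q ^ n <= 1)%R.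
{ rewrite <- (pow1 n); apply pow_incr; split; [apply Cmod_ge_0|lra]. }
generalize (Cmod_ge_0 q) (pow_le (Cmod q) n (Cmod_ge_0 q)); nra.
Qed.

Lemma qpoch_shift_neq (q u : C) (k : nat) :
  (forall n, u * q ^ n <> 1) -> forall n, u * q ^ k * q ^ n <> 1.
Proof.
intros H n; rewrite <- Cmult_assoc, <- Cpow_add_r; apply H.
Qed.

Lemma vwp_cert_S (q a c d x : C) (k m : nat) :
  (Cmod q < 1)%R -> d <> 0 -> x <> 0 ->
  (forall n, c * d * q * q ^ n <> 1) -> (forall n, a * x * q * q ^ n <> 1) ->
  vwp_cert q a c d x k (S m) =
  vwp_cert q a c d x k m + vwp_term q a c d x k (S m)
  - (1 - x * d * q ^ S k) * vwp_term q a c d x (S k) m.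
Proof.
intros Hq Hd Hx Hcd Hax; unfold vwp_cert, vwp_term.
replace (k + S m + 1)%nat with (S (k + m + 1)) by lia.
replace (S k + m + 1)%nat with (S (k + m + 1)) by lia.
replace (k + S m + 2)%nat with (S (S (k + m + 1))) by lia.
replace (k + m + 2)%nat with (S (k + m + 1)) by lia.
replace (S k + m + 2)%nat with (S (S (k + m + 1))) by lia.
replace (2 * (k + S m) + 2)%nat with (k + k + m + m + 4)%nat by lia.
replace (2 * (S k + m) + 2)%nat with (k + k + m + m + 4)%nat by lia.
(* Every symbol is brought to one common base and length, the surplus factors being split off on the
   left or right. The symbols then act as free variables [P1] to [P7], and a rational identity in
   [q ^ k] and [q ^ m] remains. *)
rewrite !(qpoch_S_l (c * d * q * q ^ k)).
rewrite (qpoch_S_l (c * q / x * q ^ k)), (qpoch_S_l (q * q ^ k)).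
rewrite (qpoch_S_l (a * c * q ^ S (k + m + 1)) q k).
replace (a * c * q ^ S (k + m + 1) * q) with (a * c * q ^ S (S (k + m + 1)))
  by (simpl; ring).
replace (c * d * q * q ^ k * q) with (c * d * q * q ^ S k) by (simpl; ring).
replace (c * q / x * q ^ k * q) with (c * q / x * q ^ S k) by (simpl; ring).
replace (q * q ^ k * q) with (q * q ^ S k) by (simpl; ring).
rewrite !qpoch_S_r.
assert (N1 := qpoch_neq_0 q q m (fun n => Cpow_q_neq_1 q n Hq)).
assert (N2 := qpoch_neq_0 q _ (k + m + 1) (qpoch_shift_neq q _ (S k) Hcd)).
assert (N3 := qpoch_neq_0 q _ (k + m + 1) Hax).
assert (N4 := one_sub_neq_0 _ (Cpow_q_neq_1 q m Hq)).
assert (N5 := one_sub_neq_0 _ (Hcd k)).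
assert (N6 := one_sub_neq_0 _ (Hax (k + m + 1)%nat)).
assert (N7 := one_sub_neq_0 _ (qpoch_shift_neq q _ (S k) Hcd (k + m + 1)%nat)).
generalize dependent (qpoch q q m); intros P1 N1.
generalize dependent (qpoch (c * d * q * q ^ S k) q (k + m + 1)); intros P2 N2.
generalize dependent (qpoch (a * x * q) q (k + m + 1)); intros P3 N3.
generalize (qpoch (a * q / d) q m) (qpoch (c * q / x * q ^ S k) q m)
  (qpoch (q * q ^ S k) q m) (qpoch (a * c * q ^ S (S (k + m + 1))) q k).
intros P4 P5 P6 P7.
replace (2 * k + 2)%nat with (k + k + 2)%nat by lia.
revert N4 N5 N6 N7.
rewrite !Cpow_S, !Cpow_add_r, !Cpow_S.
replace (q ^ 0) with (1 : C) by reflexivity.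
rewrite !Cmult_1_r.
generalize (q ^ k) (q ^ m) ((x * d) ^ m); intros p y z.
intros N4 N5 N6 N7.
field.
repeat split; try assumption.
Qed.

Lemma vwp_cert_0 (q a c d x : C) (k : nat) :
  (forall n, c * d * q * q ^ n <> 1) -> (forall n, a * x * q * q ^ n <> 1) ->
  vwp_cert q a c d x k 0 = vwp_term q a c d x k 0.
Proof.
intros Hcd Hax; unfold vwp_cert, vwp_term.
replace (k + 0 + 2)%nat with (S (k + 0 + 1)) by lia.
rewrite !qpoch_S_r.
assert (N2 := qpoch_neq_0 q _ (k + 0 + 1) (qpoch_shift_neq q _ k Hcd)).
assert (N3 := qpoch_neq_0 q _ (k + 0 + 1) Hax).
assert (N5 := one_sub_neq_0 _ (qpoch_shift_neq q _ k Hcd (k + 0 + 1)%nat)).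
generalize dependent (qpoch (c * d * q * q ^ k) q (k + 0 + 1)); intros P2 N2.
generalize dependent (qpoch (a * x * q) q (k + 0 + 1)); intros P3 N3.
generalize (qpoch (a * c * q ^ S (k + 0 + 1)) q k); intros P7.
replace (2 * k + 2)%nat with (k + k + 2)%nat by lia.
replace (2 * (k + 0) + 2)%nat with (k + k + 2)%nat by lia.
replace (k + 0 + 1)%nat with (k + 1)%nat in * by lia.
revert N5; simpl qpoch; rewrite !Cpow_S, !Cpow_add_r, !Cpow_S.
replace (q ^ 0) with (1 : C) by reflexivity.
replace ((x * d) ^ 0) with (1 : C) by reflexivity.
rewrite !Cmult_1_r.
generalize (q ^ k); intros p N5; field.
repeat split; assumption.
Qed.

Lemma Cmod_mult_le (u v : C) (A B : R) :
  (Cmod u <= A)%R -> (Cmod v <= B)%R -> (Cmod (u * v) <= A * B)%R.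
Proof.
intros; rewrite Cmod_mult; apply Rmult_le_compat; auto using Cmod_ge_0.
Qed.

Lemma Cmod_inv_le (v : C) (e : R) :
  (0 < e)%R -> (e <= Cmod v)%R -> (Cmod (/ v) <= / e)%R.
Proof.
intros He Hv; rewrite Cmod_inv.
- apply Rinv_le_contravar; assumption.
- apply Cmod_gt_0; lra.
Qed.

Lemma Cmod_mult_ge (u v : C) (A B : R) :
  (0 < A)%R -> (0 < B)%R ->
  (A <= Cmod u)%R -> (B <= Cmod v)%R -> (A * B <= Cmod (u * v))%R.
Proof.
intros; rewrite Cmod_mult; apply Rmult_le_compat; lra.
Qed.

Lemma Cmod_mul_pow_le (q u : C) (k : nat) :
  (Cmod q < 1)%R -> (Cmod (u * q ^ k) <= Cmod u)%R.
Proof.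
intros Hq; rewrite Cmod_mult, Cmod_pow.
rewrite <- (Rmult_1_r (Cmod u)) at 2.
apply Rmult_le_compat_l; [apply Cmod_ge_0|].
rewrite <- (pow1 k); apply pow_incr; split; [apply Cmod_ge_0|lra].
Qed.

Lemma qpoch_shift_bound (q u : C) :
  (Cmod q < 1)%R ->
  exists B, (0 < B)%R /\ forall k n, (Cmod (qpoch (u * q ^ k) q n) <= B)%R.
Proof.
intros Hq; destruct (Cmod_qpoch_bound q (Cmod u) Hq) as (B & HB & H).
exists B; split; [exact HB|]; intros k n; apply H, Cmod_mul_pow_le, Hq.
Qed.

(** Uniformity in the shift [k] comes from [(u)_(k+n) = (u)_k (u q^k)_n]: the left side is bounded
    below and [(u)_k] is bounded above. *)
Lemma qpoch_shift_lower (q u : C) :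
  (Cmod q < 1)%R -> (forall n, u * q ^ n <> 1) ->
  exists e, (0 < e)%R /\ forall k n, (e <= Cmod (qpoch (u * q ^ k) q n))%R.
Proof.
intros Hq Hu.
destruct (Cmod_qpoch_lower q u Hq Hu) as (e & He & H).
destruct (Cmod_qpoch_bound q (Cmod u) Hq) as (B & HB & HB').
exists (e / B)%R; split; [apply Rdiv_lt_0_compat; assumption|].
intros k n; specialize (H (k + n)%nat).
rewrite qpoch_add, Cmod_mult in H.
apply (Rmult_le_reg_l B); [exact HB|].
replace (B * (e / B))%R with e by (field; lra).
eapply Rle_trans; [exact H|]; apply Rmult_le_compat_r; [apply Cmod_ge_0|].
apply HB'; lra.
Qed.

(** The constant does not depend on [k]: the bound on the terms justifies the interchange of
    summations, the one on the certificate makes it vanish in the limit. *)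
Lemma vwp_bound (q a c d x : C) :
  (Cmod q < 1)%R ->
  (forall n, c * d * q * q ^ n <> 1) -> (forall n, a * x * q * q ^ n <> 1) ->
  exists M, forall k m,
   (Cmod (vwp_term q a c d x k m) <= M * Cmod (x * d) ^ m)%R /\
   (Cmod (vwp_cert q a c d x k m) <= M * Cmod (x * d) ^ m)%R.
Proof.
intros Hq Hcd Hax.
destruct (Cmod_qpoch_bound q (Cmod (a * q / d)) Hq) as (B1 & _ & H1).
destruct (qpoch_shift_bound q (c * q / x) Hq) as (B2 & _ & H2).
destruct (qpoch_shift_bound q q Hq) as (B3 & _ & H3).
destruct (qpoch_shift_bound q (a * c) Hq) as (B4 & _ & H4).
destruct (Cmod_qpoch_lower q q Hq (fun n => Cpow_q_neq_1 q n Hq))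
  as (e1 & He1 & L1).
destruct (qpoch_shift_lower q _ Hq Hcd) as (e2 & He2 & L2).
destruct (Cmod_qpoch_lower q _ Hq Hax) as (e3 & He3 & L3).
assert (Hs : forall u n, (Cmod (1 - u * q ^ n) <= 1 + Cmod u)%R).
{ intros u n; eapply Rle_trans; [apply Cmod_1_sub_le|].
  apply Rplus_le_compat_l, Cmod_mul_pow_le, Hq. }
(* [Y] dominates both leading factors, [1 - a c q^(2(k+m)+2)] of the term and [1 - c d q^(2k+2)] of
   the certificate. *)
set (Y := (1 + Cmod (a * c) + (1 + Cmod (c * d)))%R).
exists (Y * B1 * B2 * B3 * B4 * / (e1 * e2 * e3))%R; intros k m.
unfold vwp_term, vwp_cert, Cdiv.
replace (Y * B1 * B2 * B3 * B4 * / (e1 * e2 * e3) * Cmod (x * d) ^ m)%R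
  with (Y * Cmod (x * d) ^ m * B1 * B2 * B3 * B4 * / (e1 * e2 * e3))%R by ring.
assert (He : (0 < e1 * e2)%R) by (apply Rmult_lt_0_compat; assumption).
assert (He' : (0 < e1 * e2 * e3)%R) by (apply Rmult_lt_0_compat; assumption).
split.
all: apply Cmod_mult_le;
  [| apply Cmod_inv_le; [exact He'|];
     apply Cmod_mult_ge; auto; apply Cmod_mult_ge; auto].
all: repeat apply Cmod_mult_le; auto using Rle_refl.
all: try (rewrite Cmod_pow; apply Rle_refl).
all: eapply Rle_trans; [apply Hs|]; unfold Y;
  generalize (Cmod_ge_0 (a * c)) (Cmod_ge_0 (c * d)); lra.
Qed.

Lemma is_lim_seq_geom_bound (u : nat -> R) (M rho : R) :
  (0 <= rho < 1)%R -> (forall n, 0 <= u n <= M * rho ^ n)%R ->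
  is_lim_seq u 0.
Proof.
intros Hr Hu.
apply (is_lim_seq_le_le (fun _ => 0%R) _ (fun n => M * rho ^ n)%R); auto.
- apply is_lim_seq_const.
- replace (Finite 0) with (Rbar_mult M 0) by (simpl; f_equal; ring).
  apply is_lim_seq_scal_l, is_lim_seq_geom; rewrite Rabs_pos_eq; lra.
Qed.

Lemma is_series_vwp_0 (q a c d x : C) :
  (Cmod q < 1)%R -> d <> 0 -> x <> 0 -> (Cmod (x * d) < 1)%R ->
  (forall n, c * d * q * q ^ n <> 1) -> (forall n, a * x * q * q ^ n <> 1) ->
  is_series (vwp_term q a c d x 0) (/ (1 - x * d)).
Proof.
intros Hq Hd Hx Hxd Hcd Hax.
(* The telescoping rests on the identity, with [p = q ^ m]: [(1 - cdqp)(1 - axqp) - xd (1 - aqp/d)(1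
   - cqp/x) = (1 - xd)(1 - acq^2 p^2)]. *)
set (T := fun m => (x * d) ^ m * qpoch (a * q / d) q m * qpoch (c * q / x) q m
  / (qpoch (c * d * q) q m * qpoch (a * x * q) q m)).
assert (Nxd : 1 - x * d <> 0).
{ apply one_sub_neq_0; intros E; rewrite E, Cmod_1 in Hxd; lra. }
assert (ET : forall m, vwp_term q a c d x 0 m = (T m - T (S m)) / (1 - x * d)).
{ intros m; unfold vwp_term, T; simpl (0 + m)%nat.
  replace (m + 1)%nat with (S m) by lia.
  change (q ^ 0) with (1 : C); rewrite !Cmult_1_r, !qpoch_S_r, Cpow_S.
  change (qpoch (a * c * q ^ (m + 2)) q 0) with (1 : C).
  assert (N1 := qpoch_neq_0 q q m (fun n => Cpow_q_neq_1 q n Hq)).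
  assert (N2 := qpoch_neq_0 q _ m Hcd).
  assert (N3 := qpoch_neq_0 q _ m Hax).
  assert (N4 := one_sub_neq_0 _ (Hcd m)).
  assert (N5 := one_sub_neq_0 _ (Hax m)).
  generalize dependent (qpoch q q m); intros P1 N1.
  generalize dependent (qpoch (c * d * q) q m); intros P2 N2.
  generalize dependent (qpoch (a * x * q) q m); intros P3 N3.
  generalize (qpoch (a * q / d) q m) (qpoch (c * q / x) q m); intros P4 P5.
  replace (2 * m + 2)%nat with (m + m + 2)%nat by lia.
  revert N4 N5; rewrite !Cpow_add_r, !Cpow_S.
  change (q ^ 0) with (1 : C); rewrite !Cmult_1_r.
  generalize (q ^ m) ((x * d) ^ m); intros p z N4 N5.
  field; repeat split; assumption. }
assert (ES : forall n, sum_n (vwp_term q a c d x 0) n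
                       = (1 - T (S n)) / (1 - x * d) :> C).
{ assert (T0 : T O = 1).
  { unfold T; simpl; field; exact C1_nz. }
  induction n as [|n IH].
  - rewrite sum_n_C0, ET, T0; reflexivity.
  - rewrite sum_n_CS, IH, ET; field; exact Nxd. }
(* The error of the partial sum is [T (S n) / (1 - x * d)] up to sign, and [T n] is [(x * d) ^ n]
   times a bounded factor. *)
destruct (Cmod_qpoch_bound q (Cmod (a * q / d)) Hq) as (B1 & _ & H1).
destruct (Cmod_qpoch_bound q (Cmod (c * q / x)) Hq) as (B2 & _ & H2).
destruct (Cmod_qpoch_lower q _ Hq Hcd) as (e2 & He2 & L2).
destruct (Cmod_qpoch_lower q _ Hq Hax) as (e3 & He3 & L3).
apply is_series_Cmod.
apply (is_lim_seq_geom_bound _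
  (Cmod (x * d) * B1 * B2 * / (e2 * e3) * / Cmod (1 - x * d))%R (Cmod (x * d)));
  [split; [apply Cmod_ge_0|exact Hxd]|].
intros n; split; [apply Cmod_ge_0|].
rewrite ES.
replace ((1 - T (S n)) / (1 - x * d) - / (1 - x * d))
  with (- (T (S n) * / (1 - x * d)))
  by (change C_AbelianMonoid with C; field; exact Nxd).
rewrite Cmod_opp.
replace (Cmod (x * d) * B1 * B2 * / (e2 * e3) * / Cmod (1 - x * d)
         * Cmod (x * d) ^ n)%R
  with (Cmod (x * d) ^ S n * B1 * B2 * / (e2 * e3) * / Cmod (1 - x * d))%R
  by (simpl; ring).
unfold T, Cdiv; apply Cmod_mult_le;
  [|rewrite Cmod_inv by exact Nxd; apply Rle_refl].
apply Cmod_mult_le;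
  [|apply Cmod_inv_le; [apply Rmult_lt_0_compat; assumption|];
    apply Cmod_mult_ge; auto].
repeat apply Cmod_mult_le; auto using Rle_refl.
rewrite Cmod_pow; apply Rle_refl.
Qed.

Lemma is_series_vwp (q a c d x : C) (k : nat) :
  (Cmod q < 1)%R -> d <> 0 -> x <> 0 -> (Cmod (x * d) < 1)%R ->
  (forall n, c * d * q * q ^ n <> 1) -> (forall n, a * x * q * q ^ n <> 1) ->
  is_series (vwp_term q a c d x k) (/ qpoch (x * d) q (S k)).
Proof.
intros Hq Hd Hx Hxd Hcd Hax.
assert (Nx : forall n, x * d * q ^ n <> 1).
{ intros n E; generalize (Cmod_mul_pow_le q (x * d) n Hq).
  rewrite E, Cmod_1; lra. }
induction k as [|k IH].
- replace (qpoch (x * d) q 1) with (1 - x * d) by (simpl; ring).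
  apply is_series_vwp_0; assumption.
- assert (N := one_sub_neq_0 _ (Nx (S k))).
  (* The certificate is the discrepancy between the two partial sums. As it tends to 0, the sum for
     [S k] is the sum for [k] divided by [1 - x d q^(k+1)], which supplies the next factor of
     [qpoch (x * d) q]. *)
  assert (E : forall n, (1 - x * d * q ^ S k) * sum_n (vwp_term q a c d x (S k)) n
      = sum_n (vwp_term q a c d x k) (S n) - vwp_cert q a c d x k (S n)).
  { induction n as [|n IHn].
    - rewrite sum_n_CS, !sum_n_C0, vwp_cert_S, vwp_cert_0 by assumption; ring.
    - rewrite sum_n_CS, Cmult_plus_distr_l, IHn.
      rewrite (sum_n_CS _ (S n)), (vwp_cert_S q a c d x k (S n)) by assumption.
      ring. }
  destruct (vwp_bound q a c d x Hq Hcd Hax) as (M & HM).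
  apply is_series_Cmod in IH; apply is_lim_seq_incr_1 in IH.
  apply is_series_Cmod.
  set (v := Cmod (1 - x * d * q ^ S k)).
  assert (Hv : (0 < v)%R) by (apply Cmod_gt_0; exact N).
  apply (is_lim_seq_le_le (fun _ => 0%R) _ (fun n => / v *
    (Cmod (sum_n (vwp_term q a c d x k) (S n) - / qpoch (x * d) q (S k))
     + Cmod (vwp_cert q a c d x k (S n))))%R).
  + intros n; split; [apply Cmod_ge_0|].
    apply (Rmult_le_reg_l v); [exact Hv|].
    rewrite <- Rmult_assoc, Rinv_r, Rmult_1_l by lra.
    unfold v at 1; rewrite <- Cmod_mult.
    replace ((1 - x * d * q ^ S k) *
      (sum_n (vwp_term q a c d x (S k)) n - / qpoch (x * d) q (S (S k))))
      with ((sum_n (vwp_term q a c d x k) (S n) - / qpoch (x * d) q (S k))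
            + - vwp_cert q a c d x k (S n)).
    * eapply Rle_trans; [apply Cmod_triangle|]; rewrite Cmod_opp; apply Rle_refl.
    * rewrite (qpoch_S_r _ _ (S k)).
      assert (N' := qpoch_neq_0 q (x * d) (S k) Nx).
      generalize (E n); intros E'; symmetry.
      transitivity ((1 - x * d * q ^ S k) * sum_n (vwp_term q a c d x (S k)) n
                    - / qpoch (x * d) q (S k)).
      -- field; split; assumption.
      -- rewrite E'; ring.
  + apply is_lim_seq_const.
  + assert (Hc : is_lim_seq (fun n => Cmod (vwp_cert q a c d x k (S n))) 0).
    { apply (is_lim_seq_incr_1 (fun n => Cmod (vwp_cert q a c d x k n))).
      apply (is_lim_seq_geom_bound _ M (Cmod (x * d)));
        [split; [apply Cmod_ge_0|exact Hxd]|].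
      intros n; split; [apply Cmod_ge_0|apply HM]. }
    assert (Hs := is_lim_seq_plus' _ _ 0%R 0%R IH Hc).
    replace (Finite 0) with (Rbar_mult (/ v)%R (0 + 0)%R)
      by (simpl; f_equal; ring).
    exact (is_lim_seq_scal_l _ (/ v)%R _ Hs).
Qed.

(** * Absolute convergence of the left-hand series *)

Lemma qpochs_app (l l' : list C) (q : C) (n : nat) :
  qpochs (l ++ l') q n = qpochs l q n * qpochs l' q n.
Proof.
induction l as [|a l IH]; simpl; [ring|].
unfold qpochs in *; rewrite IH; ring.
Qed.

Lemma qpochs_cons (a : C) (l : list C) (q : C) (n : nat) :
  qpochs (a :: l) q n = qpoch a q n * qpochs l q n.
Proof. reflexivity. Qed.

Lemma qpochs_bound (q : C) (l : list C) :
  (Cmod q < 1)%R ->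
  exists B, (0 < B)%R /\ forall n, (Cmod (qpochs l q n) <= B)%R.
Proof.
intros Hq; induction l as [|a l (B & HB & H)].
- exists 1%R; split; [lra|]; intros n; simpl; rewrite Cmod_1; lra.
- destruct (Cmod_qpoch_bound q (Cmod a) Hq) as (B' & HB' & H').
  exists (B' * B)%R; split; [apply Rmult_lt_0_compat; assumption|].
  intros n; rewrite qpochs_cons; apply Cmod_mult_le; [apply H'; lra|apply H].
Qed.

Lemma qpochs_lower (q : C) (l : list C) :
  (Cmod q < 1)%R -> (forall a n, In a l -> a * q ^ n <> 1) ->
  exists e, (0 < e)%R /\ forall n, (e <= Cmod (qpochs l q n))%R.
Proof.
intros Hq; induction l as [|a l IH]; intros Hl.
- exists 1%R; split; [lra|]; intros n; simpl; rewrite Cmod_1; lra.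
- destruct IH as (e & He & H); [intros; apply Hl; right; assumption|].
  destruct (Cmod_qpoch_lower q a Hq) as (e' & He' & H').
  { intros n; apply Hl; left; reflexivity. }
  exists (e' * e)%R; split; [apply Rmult_lt_0_compat; assumption|].
  intros n; rewrite qpochs_cons; apply Cmod_mult_ge; auto.
Qed.

Lemma qpochs_eq_0 (q a : C) (l : list C) (j n : nat) :
  In a l -> a * q ^ j = 1 -> (j < n)%nat -> qpochs l q n = 0.
Proof.
intros Ha Ej Hn; induction l as [|b l IH]; [destruct Ha|].
rewrite qpochs_cons; destruct Ha as [->|Ha].
- rewrite (qpoch_eq_0 q a j n Ej Hn); ring.
- rewrite (IH Ha); ring.
Qed.

Lemma Cpowz_of_nat (z : C) (n : nat) : Cpowz z (Z.of_nat n) = z ^ n.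
Proof.
destruct n as [|n]; [reflexivity|].
cbn [Z.of_nat Cpowz]; rewrite SuccNat2Pos.id_succ; reflexivity.
Qed.

Lemma Cmod_tau (q : C) (n : nat) :
  Cmod (tau q n) = (Cmod q ^ (n * (n - 1) / 2))%R.
Proof.
unfold tau; rewrite Cmod_mult, !Cmod_pow, Cmod_opp, Cmod_1, pow1; ring.
Qed.

Lemma triangular_S (n : nat) :
  (S n * (S n - 1) / 2 = n * (n - 1) / 2 + n)%nat.
Proof.
rewrite <- Nat.div_add by lia; f_equal; destruct n; simpl; [reflexivity|].
rewrite Nat.sub_0_r; lia.
Qed.

(** The ratio of consecutive terms is [Z * |q|^n], which tends to 0. *)
Lemma ex_series_tau (q : C) (Z : R) :
  q <> 0 -> (Cmod q < 1)%R -> (0 < Z)%R ->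
  ex_series (fun n => Cmod (tau q n) * Z ^ n)%R.
Proof.
intros Hq0 Hq HZ.
assert (Hp : (0 < Cmod q)%R) by (apply Cmod_gt_0; exact Hq0).
assert (Hpos : forall n, (0 < Cmod (tau q n) * Z ^ n)%R).
{ intros n; rewrite Cmod_tau.
  apply Rmult_lt_0_compat; apply pow_lt; assumption. }
apply (ex_series_ext (fun n => Rabs (Cmod (tau q n) * Z ^ n))%R).
{ intros n; apply Rabs_pos_eq, Rlt_le, Hpos. }
apply ex_series_DAlembert with 0%R; [lra| |].
- intros n; apply Rgt_not_eq, Hpos.
- apply (is_lim_seq_ext (fun n => Z * Cmod q ^ n)%R).
  + intros n.
    replace (Cmod (tau q (S n)) * Z ^ S n / (Cmod (tau q n) * Z ^ n))%R
      with (Z * Cmod q ^ n)%R.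
    * symmetry; apply Rabs_pos_eq, Rmult_le_pos; [lra|apply pow_le; lra].
    * rewrite !Cmod_tau, triangular_S, pow_add; simpl pow; field.
      split; apply pow_nonzero; lra.
  + replace (Finite 0) with (Rbar_mult Z 0) by (simpl; f_equal; ring).
    apply is_lim_seq_scal_l, is_lim_seq_geom; rewrite Rabs_pos_eq; lra.
Qed.

Lemma ex_series_scal_Rl (M : R) (u : nat -> R) :
  ex_series u -> ex_series (fun n => M * u n)%R.
Proof. exact (ex_series_scal (K := R_AbsRing) (V := R_NormedModule) M u). Qed.

Lemma ex_series_le_R (u v : nat -> R) :
  (forall n, 0 <= u n <= v n)%R -> ex_series v -> ex_series u.
Proof.
intros H; apply (ex_series_le (K := R_AbsRing) (V := R_CompleteNormedModule)).
intros n; unfold norm; simpl; unfold abs; simpl.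
rewrite Rabs_pos_eq; apply H.
Qed.

Lemma ex_series_lim_Cmod_0 (u : nat -> C) :
  ex_series u -> is_lim_seq (fun n => Cmod (u n)) 0.
Proof.
intros (l & H); apply is_series_Cmod in H.
apply is_lim_seq_incr_1.
apply (is_lim_seq_le_le (fun _ => 0%R) _
  (fun n => Cmod (sum_n u (S n) - l) + Cmod (sum_n u n - l))%R).
- intros n; split; [apply Cmod_ge_0|].
  assert (E : u (S n) = (sum_n u (S n) - l) + - (sum_n u n - l) :> C)
    by (rewrite sum_n_CS; ring).
  rewrite E.
  eapply Rle_trans; [apply Cmod_triangle|]; rewrite Cmod_opp; apply Rle_refl.
- apply is_lim_seq_const.
- replace (Finite 0) with (Finite (0 + 0)) by (f_equal; ring).
  apply is_lim_seq_plus'; [|exact H].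
  apply is_lim_seq_incr_1 in H; exact H.
Qed.

(* When [length al = length bl] the terms are [z^n] times a factor that is
   either eventually zero or bounded away from zero, so that mere convergence
   already forces termination or [|z| < 1]. *)
Lemma ex_series_Cmod_tphi_term (q : C) (al bl : list C) (z : C) :
  q <> 0 -> (Cmod q < 1)%R -> (length al <= length bl)%nat ->
  (forall b n, In b bl -> b * q ^ n <> 1) ->
  (length al = length bl -> ex_series (tphi_term al bl q z)) ->
  ex_series (fun n => Cmod (tphi_term al bl q z n)).
Proof.
intros Hq0 Hq Hl Hbl Hconv.
destruct (qpochs_bound q al Hq) as (B & HB & HBn).
destruct (qpochs_lower q bl Hq Hbl) as (e & He & Hen).
assert (Hquo : forall n, (Cmod (qpochs al q n / qpochs bl q n) <= B * / e)%R).
{ intros n; apply Cmod_mult_le; [apply HBn|apply Cmod_inv_le; auto]. }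
assert (Et : forall n, tphi_term al bl q z n = qpochs al q n / qpochs bl q n
  * tau q n ^ (length bl - length al) * z ^ n).
{ intros n; unfold tphi_term; rewrite <- Nat2Z.inj_sub by exact Hl.
  rewrite Cpowz_of_nat; reflexivity. }
destruct (Nat.eq_dec (length al) (length bl)) as [El|El].
- specialize (Hconv El).
  rewrite El, Nat.sub_diag in Et.
  destruct (classic (exists a j, In a al /\ a * q ^ j = 1)) as
    [(a & j & Ha & Ej)|Hnz].
  + apply (ex_series_incr_n _ (S j)).
    apply (ex_series_ext (fun _ => 0%R)).
    * intros n; rewrite Et, (qpochs_eq_0 q a al j) by (auto; lia).
      unfold Cdiv; rewrite !Cmult_0_l, Cmod_0; reflexivity.
    * apply (ex_series_ext (fun n => 0 * (1 / 2) ^ n)%R);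
        [intros; apply Rmult_0_l|].
      apply ex_series_scal_Rl, ex_series_geom; rewrite Rabs_pos_eq; lra.
  + destruct (qpochs_lower q al Hq) as (e' & He' & Hen').
    { intros a j Ha Ej; apply Hnz; exists a, j; split; assumption. }
    destruct (qpochs_bound q bl Hq) as (B' & HB' & HBn').
    assert (Hge : forall n, (e' * / B' <= Cmod (qpochs al q n / qpochs bl q n))%R).
    { intros n; apply Cmod_mult_ge; auto using Rinv_0_lt_compat.
      generalize (Hen n); intros.
      rewrite Cmod_inv by (apply Cmod_gt_0; lra).
      apply Rinv_le_contravar; [lra|apply HBn']. }
    (* If [|z| >= 1], every term has modulus at least [e' / B'], contrary to convergence. *)
    assert (Hz : (Cmod z < 1)%R).
    { destruct (Rlt_or_le (Cmod z) 1) as [h|h]; [exact h|exfalso].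
      assert (Hp : (0 < e' * / B')%R)
        by (apply Rmult_lt_0_compat; auto using Rinv_0_lt_compat).
      apply ex_series_lim_Cmod_0, is_lim_seq_spec in Hconv.
      destruct (Hconv (mkposreal _ Hp)) as [N HN].
      specialize (HN N (le_n N)); simpl in HN.
      rewrite Rminus_0_r, Rabs_pos_eq in HN by apply Cmod_ge_0.
      rewrite Et in HN; simpl in HN; rewrite Cmult_1_r, Cmod_mult, Cmod_pow in HN.
      generalize (Hge N) (pow_R1_Rle _ N h); nra. }
    apply (ex_series_le_R _ (fun n => B * / e * Cmod z ^ n)%R).
    * intros n; split; [apply Cmod_ge_0|].
      rewrite Et; simpl; rewrite Cmult_1_r.
      apply Cmod_mult_le; [apply Hquo|rewrite Cmod_pow; apply Rle_refl].
    * apply ex_series_scal_Rl, ex_series_geom.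
      rewrite Rabs_pos_eq; [exact Hz|apply Cmod_ge_0].
(* One factor [tau q n] already forces convergence; the other [j] have modulus at most 1. Replacing
   [|z|] by [|z| + 1] gives the strictly positive ratio that [ex_series_tau] asks for. *)
- destruct (length bl - length al)%nat as [|j] eqn:Ej; [lia|].
  apply (ex_series_le_R _
    (fun n => B * / e * (Cmod (tau q n) * (Cmod z + 1) ^ n))%R).
  + intros n; split; [apply Cmod_ge_0|].
    rewrite Et, <- Rmult_assoc.
    apply Cmod_mult_le; [apply Cmod_mult_le; [apply Hquo|]|].
    * rewrite Cpow_S, Cmod_mult.
      apply Rle_trans with (Cmod (tau q n) * 1)%R; [|lra].
      apply Rmult_le_compat_l; [apply Cmod_ge_0|].
      rewrite Cmod_pow, <- (pow1 j); apply pow_incr.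
      split; [apply Cmod_ge_0|].
      rewrite Cmod_tau, <- (pow1 (n * (n - 1) / 2)); apply pow_incr.
      split; [apply Cmod_ge_0|lra].
    * rewrite Cmod_pow; apply pow_incr; split; [apply Cmod_ge_0|lra].
  + apply ex_series_scal_Rl, ex_series_tau; auto.
    generalize (Cmod_ge_0 z); lra.
Qed.

(** * Matching the right-hand side with the double sum *)

(* [(q^(-n))_k / (q^(-n) d/a)_k] with [n = k + m], cleared of denominators. *)
Lemma qpoch_reverse_ratio (q a d : C) (k m : nat) :
  q <> 0 -> a <> 0 -> d <> 0 ->
  qpoch (/ q ^ (k + m)) q k * qpoch (a * q / d) q (k + m) * qpoch q q m * d ^ k
  = qpoch (/ q ^ (k + m) * d / a) q k * qpoch q q (k + m)
    * qpoch (a * q / d) q m * a ^ k.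
Proof.
intros Hq Ha Hd; induction k as [|k IH]; [simpl; ring|].
assert (Hp : q ^ (k + m) <> 0) by (apply Cpow_nz; exact Hq).
rewrite !qpoch_S_l.
replace (S k + m)%nat with (S (k + m)) by lia.
rewrite !Cpow_S, !qpoch_S_r.
replace (/ (q * q ^ (k + m)) * q) with (/ q ^ (k + m)) by (field; auto).
replace (/ (q * q ^ (k + m)) * d / a * q) with (/ q ^ (k + m) * d / a)
  by (field; auto).
transitivity ((1 - / (q * q ^ (k + m))) * (1 - a * q / d * q ^ (k + m)) * d *
  (qpoch (/ q ^ (k + m)) q k * qpoch (a * q / d) q (k + m) * qpoch q q m * d ^ k));
  [ring|].
rewrite IH.
generalize (qpoch (/ q ^ (k + m) * d / a) q k) (qpoch q q (k + m))
  (qpoch (a * q / d) q m) (a ^ k); intros.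
revert Hp; generalize (q ^ (k + m)); intros; field; auto.
Qed.

(** Reversing [(q^(-n))_k / (q^(-n) d/a)_k] produces [(a/d)^k], which turns [(xd)^(k+m) (t/a)^k]
    into [(xt)^k (xd)^m]. The factor [qpoch (x * d * q) q k] undoes the denominator parameter [xdq]
    of the left-hand term. *)
Lemma outer_phi_term (q : C) (al bl : list C) (a c d x t : C) (k m : nat) :
  q <> 0 -> (Cmod q < 1)%R -> a <> 0 -> d <> 0 -> x <> 0 ->
  (forall n, c * d * q * q ^ n <> 1) -> (forall n, a * x * q * q ^ n <> 1) ->
  (forall n, a * q / d * q ^ n <> 1) ->
  (forall n, x * d * q * q ^ n <> 1) ->
  (forall b n, In b bl -> b * q ^ n <> 1) ->
  (1 - a * c * q ^ (2 * (k + m) + 2)) * (x * d) ^ (k + m)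
  * (qpochs [a * q / d; c * q / x] q (k + m)
     / qpochs [c * d * q; a * x * q] q (k + m + 1))
  * phi_term ([c * d * q; / q ^ (k + m); a * c * q ^ (k + m + 2)] ++ al)
      ([c * d * q ^ (k + m + 2); / q ^ (k + m) * d / a] ++ bl) q (t / a) k
  = tphi_term (al ++ [c * q / x]) (bl ++ [x * d * q]) q (x * t) k
    * qpoch (x * d * q) q k * vwp_term q a c d x k m.
Proof.
intros Hq0 Hq Ha Hd Hx Hcd Hax Had Hxd Hbl.
unfold phi_term, tphi_term; rewrite !length_app; simpl length.
(* Both sides carry the same power of [tau], of exponent [length bl - length al]. *)
replace (1 + Z.of_nat (2 + length bl) - Z.of_nat (3 + length al))%Z
  with (Z.of_nat (length bl + 1) - Z.of_nat (length al + 1))%Z by lia.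
generalize (Cpowz (tau q k)
  (Z.of_nat (length bl + 1) - Z.of_nat (length al + 1))); intros U.
rewrite !qpochs_app, !qpochs_cons.
change (qpochs [] q k) with (1 : C); change (qpochs [] q (k + m)) with (1 : C).
change (qpochs [] q (k + m + 1)) with (1 : C).
unfold vwp_term.
assert (E1 := qpoch_reverse_ratio q a d k m Hq0 Ha Hd).
(* Both products equal [(cdq)_(2k+m+1)], split at different places. *)
assert (E2 : qpoch (c * d * q) q (k + m + 1)
             * qpoch (c * d * q ^ (k + m + 2)) q k
             = qpoch (c * d * q) q k * qpoch (c * d * q * q ^ k) q (k + m + 1)).
{ rewrite <- qpoch_add; replace (c * d * q ^ (k + m + 2))
    with (c * d * q * q ^ (k + m + 1)).
  - rewrite <- qpoch_add; f_equal; lia.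
  - replace (k + m + 2)%nat with (S (k + m + 1)) by lia; simpl; ring. }
assert (E3 : (x * d) ^ (k + m) = x ^ k * d ^ k * (x * d) ^ m)
  by (rewrite Cpow_add_r, Cpow_mult_l; reflexivity).
assert (E4 : (t / a) ^ k = t ^ k / a ^ k).
{ unfold Cdiv; rewrite Cpow_mult_l, Cpow_inv by assumption; reflexivity. }
rewrite E3, E4, (Cpow_mult_l x t).
rewrite (qpoch_add (c * q / x) q k m).
rewrite (qpoch_add q q k m) in E1.
assert (Nq := fun j => qpoch_neq_0 q q j (fun n => Cpow_q_neq_1 q n Hq)).
assert (Ncd := fun j => qpoch_neq_0 q (c * d * q) j Hcd).
assert (Ncd' := fun j => qpoch_neq_0 q _ j (qpoch_shift_neq q _ k Hcd)).
assert (Nax := fun j => qpoch_neq_0 q (a * x * q) j Hax).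
assert (Nad := fun j => qpoch_neq_0 q _ j Had).
assert (Nxd := fun j => qpoch_neq_0 q _ j Hxd).
assert (Nqk := qpoch_neq_0 q _ m (qpoch_shift_neq q q k
                 (fun n => Cpow_q_neq_1 q n Hq))).
assert (Nak : a ^ k <> 0) by (apply Cpow_nz; exact Ha).
assert (Ndk : d ^ k <> 0) by (apply Cpow_nz; exact Hd).
assert (Nbl : qpochs bl q k <> 0).
{ destruct (qpochs_lower q bl Hq Hbl) as (e & He & H).
  apply Cmod_gt_0; specialize (H k); lra. }
assert (NZ : qpoch (c * d * q ^ (k + m + 2)) q k <> 0).
{ intros E; rewrite E, Cmult_0_r in E2; symmetry in E2; revert E2.
  apply Cmult_neq_0; auto. }
assert (ND : qpoch (/ q ^ (k + m) * d / a) q k <> 0).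
(* A vanishing factor of index [j < k] would mean [d = a q^(k+m-j)] with a positive exponent. *)
{ apply qpoch_neq_0_lt; intros j Hj E; apply (Had (k + m - S j)%nat).
  assert (Hqj : q ^ j <> 0) by (apply Cpow_nz; exact Hq0).
  assert (Hqm : q ^ (k + m - S j) <> 0) by (apply Cpow_nz; exact Hq0).
  replace (k + m)%nat with (S (k + m - S j) + j)%nat in E at 1 by lia.
  rewrite Cpow_add_r, Cpow_S in E.
  rewrite <- (Cmult_1_r (a * q / d * _)); rewrite <- E at 1.
  field; auto. }
specialize (Ncd' (k + m + 1)%nat).
assert (N1 := Nq k). assert (N2 := Nq m).
assert (N3 := Ncd k). assert (N4 := Ncd (k + m + 1)%nat).
assert (N5 := Nax (k + m + 1)%nat).
assert (N6 := Nad (k + m)%nat). assert (N7 := Nxd k).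
revert E1 E2 Ncd' N1 N2 N3 N4 N5 N6 N7 ND NZ Nbl Ndk Nak Nqk.
generalize (qpoch (/ q ^ (k + m) * d / a) q k) (qpoch (/ q ^ (k + m)) q k)
  (qpoch (c * d * q ^ (k + m + 2)) q k)
  (qpoch (c * d * q * q ^ k) q (k + m + 1))
  (qpoch (c * d * q) q k) (qpoch (c * d * q) q (k + m + 1))
  (qpoch (a * x * q) q (k + m + 1))
  (qpoch (a * q / d) q (k + m)) (qpoch (a * q / d) q m)
  (qpoch q q k) (qpoch q q m) (qpoch (q * q ^ k) q m)
  (qpoch (x * d * q) q k) (a ^ k) (d ^ k) (qpochs bl q k)
  (qpochs al q k) (q ^ (2 * (k + m) + 2))
  (qpoch (a * c * q ^ (k + m + 2)) q k) (qpoch (c * q / x) q k)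
  (qpoch (c * q / x * q ^ k) q m) ((x * d) ^ m) (x ^ k) (t ^ k).
clear; intros D X Z V P1 P2 P3 P4 P5 P6 P7 P8 P9 ak dk; intros.
(* [E1] and [E2] are solved for [X] and [V]; after substitution only a rational identity in the
   remaining variables is left. *)
assert (EX : X = D * P6 * P8 * P5 * ak / (P4 * P7 * dk)).
{ transitivity (X * P4 * P7 * dk / (P4 * P7 * dk)); [|rewrite E1].
  - field; auto.
  - field; auto. }
assert (EV : V = P2 * Z / P1) by (rewrite E2; field; auto).
rewrite EX, EV.
field; repeat split; assumption.
Qed.

Lemma sum_n_Cmult_l (z : C) (u : nat -> C) (n : nat) :
  sum_n (fun k => z * u k) n = z * sum_n u n :> C.
Proof.
induction n as [|n IH]; [rewrite !sum_n_C0; reflexivity|].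
rewrite !sum_n_CS, IH; ring.
Qed.

(** [Hcd] and [Hax] keep the denominators [(cdq, axq)_(n+1)] nonzero. [Hblq] includes [n = 0], since
    [b = 1] makes [(b)_n] vanish for [n >= 1]. For [r < s] the left-hand series converges by itself,
    while for [r = s] it may diverge, whence [Hconv]. As [CSeries] is unspecified on divergent
    series, convergence on the left is part of the conclusion. *)
Theorem theorem1p1
  (q : C) (Hq0 : q <> 0) (Hq1 : (Cmod q < 1)%R)
  (r s : nat) (Hrs : (r <= s)%nat)
  (al bl : list C) (Hal : length al = r) (Hbl : length bl = s)
  (a c d x t : C)
  (Ha : a <> 0) (Hd : d <> 0) (Hx : x <> 0)
  (Hxq : forall n : nat, (1 <= n)%nat -> x <> / q ^ n)
  (Hblq : forall (b : C) (n : nat), In b bl -> b <> / q ^ n)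
  (Hda : forall n : nat, (1 <= n)%nat -> d <> a * q ^ n)
  (Hcd : forall n : nat, (1 <= n)%nat -> c * d <> / q ^ n)
  (Hax : forall n : nat, (1 <= n)%nat -> a * x <> / q ^ n)
  (Hxd : (Cmod (x * d) < 1)%R)
  (Hconv : r = s ->
     ex_series (tphi_term (al ++ [c * q / x]) (bl ++ [x * d * q]) q (x * t))) :
  ex_series (tphi_term (al ++ [c * q / x]) (bl ++ [x * d * q]) q (x * t))
  /\
  is_series
    (fun n : nat =>
       (1 - a * c * q ^ (2 * n + 2)) * (x * d) ^ n
       * (qpochs [a * q / d; c * q / x] q n
          / qpochs [c * d * q; a * x * q] q (n + 1))
       * phi ([c * d * q; / q ^ n; a * c * q ^ (n + 2)] ++ al)
             ([c * d * q ^ (n + 2); / q ^ n * d / a] ++ bl) q (t / a))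
    (1 / (1 - x * d)
     * tphi (al ++ [c * q / x]) (bl ++ [x * d * q]) q (x * t)).
Proof.
assert (Nq : forall n, q ^ n <> 0) by (intros n; apply Cpow_nz, Hq0).
assert (Hinv : forall u n, u * q ^ n = 1 -> u = / q ^ n).
{ intros u n E; rewrite <- (Cmult_1_l (/ q ^ n)), <- E; field; auto. }
assert (Hcd' : forall n, c * d * q * q ^ n <> 1).
{ intros n E; apply (Hcd (S n)); [lia|]; apply Hinv.
  rewrite Cpow_S, <- E; ring. }
assert (Hax' : forall n, a * x * q * q ^ n <> 1).
{ intros n E; apply (Hax (S n)); [lia|]; apply Hinv.
  rewrite Cpow_S, <- E; ring. }
assert (Had : forall n, a * q / d * q ^ n <> 1).
{ intros n E; apply (Hda (S n)); [lia|].
  rewrite <- (Cmult_1_r d); rewrite <- E; rewrite Cpow_S; field; auto. }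
assert (Hbl' : forall b n, In b bl -> b * q ^ n <> 1).
{ intros b n Hb E; apply (Hblq b n Hb); apply Hinv.
  exact E. }
assert (Hxd0 : forall n, x * d * q ^ n <> 1).
{ intros n E; generalize (Cmod_mul_pow_le q (x * d) n Hq1).
  rewrite E, Cmod_1; lra. }
assert (Hxd' : forall n, x * d * q * q ^ n <> 1).
{ intros n; rewrite <- Cmult_assoc, <- Cpow_S; apply Hxd0. }
set (L := tphi_term (al ++ [c * q / x]) (bl ++ [x * d * q]) q (x * t)) in *.
assert (Habs : ex_series (fun n => Cmod (L n))).
{ apply ex_series_Cmod_tphi_term; auto.
  - rewrite !length_app; simpl; lia.
  - intros b n Hb; apply in_app_or in Hb; destruct Hb as [Hb|[<-|[]]]; auto.
  - rewrite !length_app; simpl; intros; apply Hconv; lia. }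
assert (HL : ex_series L).
{ apply (ex_series_le (K := C_AbsRing) (V := C_CompleteNormedModule)
    L (fun n => Cmod (L n))); [intros n; apply Rle_refl|exact Habs]. }
split; [exact HL|].
destruct (vwp_bound q a c d x Hq1 Hcd' Hax') as (M & HM).
destruct (Cmod_qpoch_bound q (Cmod (x * d * q)) Hq1) as (B & HB & HBn).
(* Row [k] belongs to the [k]-th term of the left-hand series, antidiagonal [k + m = n] to the
   [n]-th summand on the right. *)
set (H := fun k m => L k * qpoch (x * d * q) q k * vwp_term q a c d x k m).
assert (HM0 : (0 <= M)%R).
{ generalize (Cmod_ge_0 (vwp_term q a c d x 0 0)) (proj1 (HM O O)); simpl; lra. }
apply (is_series_ext (fun n => sum_n (fun k => H k (n - k)%nat) n)).
{ intros n.
  (* The parameter [/ q ^ n] kills all terms of index above [n], so the inner [phi] is a finite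
     sum. *)
  unfold phi; erewrite CSeries_correct; [|apply (is_series_finite _ n)].
  - rewrite <- sum_n_Cmult_l; apply sum_n_ext_loc; intros k Hk.
    destruct (Nat.le_exists_sub k n Hk) as (m & -> & _).
    rewrite Nat.add_sub, (Nat.add_comm m k).
    symmetry; apply outer_phi_term; auto.
  - intros k Hk; unfold phi_term; rewrite qpochs_app, !qpochs_cons.
    rewrite (qpoch_eq_0 q (/ q ^ n) n k); [|field; auto|exact Hk].
    unfold Cdiv; ring. }
apply (is_series_diagonal H (fun k => 1 / (1 - x * d) * L k) _
  (fun k => B * M * Cmod (L k))%R (Cmod (x * d))).
- split; [apply Cmod_ge_0|exact Hxd].
- intros k; apply Rmult_le_pos; [|apply Cmod_ge_0].
  apply Rmult_le_pos; [lra|exact HM0].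
- apply ex_series_scal_Rl, Habs.
- intros k m; unfold H.
  replace (B * M * Cmod (L k) * Cmod (x * d) ^ m)%R
    with (Cmod (L k) * B * (M * Cmod (x * d) ^ m))%R by ring.
  apply Cmod_mult_le; [apply Cmod_mult_le|]; [apply Rle_refl| |exact (proj1 (HM k m))].
  apply HBn, Rle_refl.
- intros k; unfold H.
  (* Since [(xd)_(k+1) = (1 - xd) (xdq)_k], the row sum leaves the same factor [1 / (1 - xd)] for
     every [k]. *)
  replace (1 / (1 - x * d) * L k)
    with (L k * qpoch (x * d * q) q k * / qpoch (x * d) q (S k)).
  + apply is_series_Cscal, is_series_vwp; auto.
  + rewrite qpoch_S_l; field; split.
    * generalize (Hxd0 O); simpl; rewrite Cmult_1_r; apply one_sub_neq_0.
    * apply qpoch_neq_0, Hxd'.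
- destruct HL as (l & Hl); apply is_series_Cscal.
  unfold tphi; fold L; rewrite (CSeries_correct _ _ Hl); exact Hl.
Qed.
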